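(* Let $\mathbb L$ be the orbit closure (under the shift) of a Toeplitz sequence $x$ in a finite alphabet, let $\mathfrak O$ be its maximal odometer factor, based on a sufficiently fast growing sequence $\langle k_n:n\in\mathbb N\rangle$, and let $\mathbb K$ be the odometer based presentation of $\mathfrak O$ with two words per level that is described in the context. Then there is an odometer based system $\mathbb L^*\subseteq\mathbb L\times\mathbb K$ and a set $A\subseteq\mathbb L^*$ that is an augmentation of $\mathbb L$ by $\mathbb K$ and has measure one for every invariant measure on $\mathbb L^*$.
   Context: Toeplitz sequences: let $\Sigma$ be a finite alphabet. For $x\in\Sigma^{\mathbb Z}$ and $p\ge1$ let $\mathrm{Per}_p(x)=\{m\in\mathbb Z: x(m)=x(m+jp)\text{ for all }j\in\mathbb Z\}$. The sequence $x$ is a Toeplitz sequence if $\mathbb Z=\bigcup_p\mathrm{Per}_p(x)$. Its orbit closure $\mathbb L\subseteq\Sigma^{\mathbb Z}$ is a minimal symbolic shift with a continuous factor map to an associated odometer. Odometers: for integers $k_n\ge2$ the odometer based on (determined by) $\langle k_n:n\in\mathbb N\rangle$ is the compact group $\prod_n\mathbb Z/k_n\mathbb Z$ with the homeomorphism that adds $(1,0,0,\dots)$ with carrying to the right. The maximal odometer factor of $\mathbb L$ is the odometer factor through which all other odometer factors of $\mathbb L$ factor. Writing $K_n=\prod_{i<n}k_i$, replacing $\langle K_n\rangle$ by an infinite subsequence (and the $k_n$ by the corresponding quotients of consecutive terms) gives an isomorphic odometer, so the same odometer can be based on sequences growing as fast as desired. Odometer based systems: a collection of words $\mathcal W$ is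 uniquely readable if whenever $u,v,w\in\mathcal W$ and $uv=pws$, then $p$ or $s$ is empty. An odometer based construction sequence in a finite alphabet $\Sigma'$ is a sequence $\langle\mathcal W_n:n\in\mathbb N\rangle$ of collections of words for which there is a sequence of integers $k_n\ge 2$ with: $\mathcal W_0=\Sigma'$; for each $n$ all words in $\mathcal W_n$ have the same length and are uniquely readable; each $w\in\mathcal W_n$ occurs at least once as a subword of every $w'\in\mathcal W_{n+1}$; and $\mathcal W_{n+1}\subseteq\mathcal W_n^{k_n}$ (concatenations of $k_n$ words of $\mathcal W_n$). Its limit is the closed shift-invariant set of $y\in(\Sigma')^{\mathbb Z}$ all of whose finite contiguous subwords occur inside some $w\in\mathcal W_n$, for some $n$. A symbolic system is odometer based if it is the limit of an odometer based construction sequence. A subset of $\Sigma^{\mathbb Z}\times\{a,b\}^{\mathbb Z}$ is viewed as a subset of $(\Sigma\times\{a,b\})^{\mathbb Z}$. The presentation $\mathbb K$: here $\sum_n 1/k_n<\infty$. Let $\mathcal W_0=\{a_0,b_0\}=\{a,b\}$ and, given $\mathcal W_n=\{a_n,b_n\}$, let $\mathcal W_{n+1}=\{a_{n+1},b_{n+1}\}\subseteq\mathcal W_n^{k_n}$, where $$a_{n+1}=a_na_na_n\,b_nb_nb_n\,a_nb_na_nb_n\cdots,\qquad b_{n+1}=b_nb_nb_n\,a_na_na_n\,a_nb_na_nb_n\cdots,$$ i.e. after the first six $n$-words both continue by alternating $a_n,b_n,a_n,b_n,\dots$ until a total of $k_n$ $n$-words is reached. $\mathbb K\subseteq\{a,b\}^{\mathbb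 Z}$ is the limit of this odometer based construction sequence; it is uniquely ergodic and measure theoretically conjugate to the odometer based on $\langle k_n\rangle$. Augmentation: let $X$ and $Y$ be minimal symbolic shifts. An augmentation of $X$ by $Y$ is a shift-invariant Borel set $A\subseteq X\times Y$ such that, if $L=\{x\in X:\text{there is exactly one }y\text{ with }(x,y)\in A\}$, then $\mu(L)=1$ for every shift-invariant probability measure $\mu$ on $X$. *)

(* Defs.v *)
From HB Require Import structures.
From mathcomp Require Import all_boot all_order all_algebra.
From mathcomp Require Import all_classical all_reals all_analysis.

Set Implicit Arguments.
Unset Strict Implicit.
Unset Printing Implicit Defensive.

Import Order.TTheory GRing.Theory Num.Theory.
Import numFieldNormedType.Exports.

Local Open Scope classical_set_scope.
Local Open Scope ring_scope.

(* Measurable types of the library are pointed, so alphabets are finite and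
   pointed, i.e. finite and nonempty. *)
#[short(type="alphabet")]
HB.structure Definition Alphabet := {S of Finite S & Pointed S}.

HB.instance Definition _ := Finite.on bool.
HB.instance Definition _ (S T : alphabet) := Finite.on (S * T)%type.

Definition fullshift (S : alphabet) : Type :=
  prod_topology (fun _ : int => discrete_topology S).

HB.instance Definition _ (S : alphabet) := Pointed.on (fullshift S).
HB.instance Definition _ (S : alphabet) := Topological.on (fullshift S).

Definition borel (T : ptopologicalType) : Type := g_sigma_algebraType (@open T).

HB.instance Definition _ (T : ptopologicalType) := Measurable.on (borel T).

Section Shifts.
Variable S : alphabet.
Implicit Types (x y : fullshift S) (X Y : set (fullshift S)).

Definition translate (n : int) y : fullshift S := fun m => y (m + n).

Definition shift y : fullshift S := translate 1 y.

Definition orbit_closure x : set (fullshift S) :=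
  closure (range (fun n : int => translate n x)).

Definition shift_invariant X : Prop := shift @^-1` X = X.

Definition symbolic_shift X : Prop := closed X /\ shift_invariant X.

Definition minimal_shift X : Prop :=
  [/\ symbolic_shift X, X !=set0 &
      forall Y, symbolic_shift Y -> Y !=set0 -> Y `<=` X -> Y = X].

Definition Per (p : nat) x : set int :=
  [set m | forall j : int, x m = x (m + j * p%:Z)].

Definition toeplitz x : Prop :=
  forall m : int, exists2 p : nat, (0 < p)%N & Per p x m.

(* The shift-invariant probability measures on a closed set X are encoded as
   the shift-invariant Borel probability measures on the full shift that give
   X measure 1. *)
Definition invariant_on (R : realType) X
    (mu : probability (borel (fullshift S)) R) : Prop :=
  (forall B : set (borel (fullshift S)),
     measurable B -> mu (shift @^-1` B) = mu B) /\ mu X = 1%E.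

End Shifts.

(* The compact space \prod_n Z/k_n; 'Z_(k n) is Z/k_n because the k_n are
   always assumed to be at least 2. *)
Definition odometer (k : nat -> nat) : Type :=
  prod_topology (fun n => discrete_topology 'Z_(k n)).

HB.instance Definition _ (k : nat -> nat) := Topological.on (odometer k).

(* Addition of (1, 0, 0, ...) with carry to the right: coordinate n is
   incremented exactly when all previous coordinates are maximal (-1 mod k_j)
   and hence overflow. *)
Definition odometer_map (k : nat -> nat) (o : odometer k) : odometer k :=
  fun n => let c j : 'Z_(k j) := o j in
    if [forall j : 'I_n, c j == -1] then c n + 1 else c n.

Definition factor_map (U V : topologicalType) (X : set U) (f : U -> U)
    (g : V -> V) (phi : U -> V) : Prop :=
  [/\ {within X, continuous phi}, phi @` X = setT &
      forall u, X u -> phi (f u) = g (phi u)].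

Definition odometer_factor (S : alphabet) (X : set (fullshift S))
    (k : nat -> nat) (phi : fullshift S -> odometer k) : Prop :=
  factor_map X (@shift S) (@odometer_map k) phi.

Definition maximal_odometer_factor (S : alphabet) (X : set (fullshift S))
    (k : nat -> nat) : Prop :=
  exists phi : fullshift S -> odometer k, odometer_factor X phi /\
    forall (k' : nat -> nat) (psi : fullshift S -> odometer k'),
      (forall n, (1 < k' n)%N) -> odometer_factor X psi ->
      exists2 rho : odometer k -> odometer k',
        factor_map setT (@odometer_map k) (@odometer_map k') rho &
        forall y, X y -> psi y = rho (phi y).

Section ConstructionSequences.
Variable S : alphabet.

Definition uniquely_readable (W : set (seq S)) : Prop :=
  forall u v w p s : seq S, W u -> W v -> W w ->
    u ++ v = p ++ w ++ s -> p = [::] \/ s = [::].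

Definition concatenations (W : set (seq S)) (l : nat) : set (seq S) :=
  [set w | exists2 ws : seq (seq S),
     size ws = l /\ (forall u, u \in ws -> W u) & w = flatten ws].

(* The alphabet S' of the construction sequence is a subset of S: a system
   in a product of alphabets need not use every pair of letters. *)
Definition construction_sequence (S' : {set S}) (W : nat -> set (seq S))
    : Prop :=
  exists k : nat -> nat,
    [/\ forall n, (1 < k n)%N,
        W 0%N = [set [:: c] | c in [set` S']],
        forall n u v, W n u -> W n v -> size u = size v,
        forall n, uniquely_readable (W n) &
        forall n, (forall w w', W n w -> W n.+1 w' -> infix w w') /\
                  W n.+1 `<=` concatenations (W n) (k n)].

Definition window (y : fullshift S) (i : int) (l : nat) : seq S :=
  mkseq (fun j => y (i + j%:Z)) l.

Definition limit (W : nat -> set (seq S)) : set (fullshift S) :=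
  [set y | forall (i : int) (l : nat),
     exists n, exists2 w, W n w & infix (window y i l) w].

Definition odometer_based (X : set (fullshift S)) : Prop :=
  exists S' : {set S}, exists2 W : nat -> set (seq S),
    construction_sequence S' W & X = limit W.

End ConstructionSequences.

(* {a, b} is bool, with a = false and b = true.  Kpattern l c lists the n-words
   making up a_{n+1} (c = a) or b_{n+1} (c = b) when k_n = l: c c c, then the
   other word three times, then a b a b ... up to a total of l.  The pattern is
   meant for l > 6; sequences k growing fast enough satisfy this. *)
Definition Kpattern (l : nat) (c : bool) : seq bool :=
  mkseq (fun i => if (i < 3)%N then c else if (i < 6)%N then ~~ c else odd i) l.

Fixpoint Kword (k : nat -> nat) (n : nat) (c : bool) : seq bool :=
  if n is m.+1 then flatten [seq Kword k m d | d <- Kpattern (k m) c]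
  else [:: c].

Definition Kshift (k : nat -> nat) : set (fullshift bool) :=
  limit (fun n => range (Kword k n)).

Section Augmentations.
Variables S T : alphabet.

Definition fstshift (z : fullshift (S * T)%type) : fullshift S :=
  fun m => (z m).1.

Definition sndshift (z : fullshift (S * T)%type) : fullshift T :=
  fun m => (z m).2.

Definition pairshift (x : fullshift S) (y : fullshift T) :
    fullshift (S * T)%type :=
  fun m => (x m, y m).

Definition prodshift (X : set (fullshift S)) (Y : set (fullshift T)) :
    set (fullshift (S * T)%type) :=
  [set z | X (fstshift z) /\ Y (sndshift z)].

Definition single_fiber (X : set (fullshift S)) (Y : set (fullshift T))
    (A : set (fullshift (S * T)%type)) : set (fullshift S) :=
  [set x | X x /\ exists! y, Y y /\ A (pairshift x y)].

(* single_fiber X Y A need not be Borel, so "has measure 1" refers to the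
   completion of mu: the complement is mu-negligible. *)
Definition augmentation (R : realType) (X : set (fullshift S))
    (Y : set (fullshift T)) (A : set (fullshift (S * T)%type)) : Prop :=
  [/\ minimal_shift X /\ minimal_shift Y,
      A `<=` prodshift X Y,
      shift_invariant A,
      measurable (A : set (borel (fullshift (S * T)%type))) &
      forall mu : probability (borel (fullshift S)) R,
        invariant_on X mu -> {ae mu, forall x, single_fiber X Y A x}].

End Augmentations.

(* k grows at the rate prescribed by g, where the bound on k_n may depend on
   k_0, ..., k_{n-1}. *)
Definition fast_growing (g : seq nat -> nat) (k : nat -> nat) : Prop :=
  forall n, (g (mkseq k n) <= k n)%N.

(* Main.v *)
Require Import Defs.
From mathcomp Require Import all_boot all_order all_algebra.
From mathcomp Require Import all_classical all_reals all_analysis.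
From mathcomp Require Import finmap zify.
Import Order.TTheory GRing.Theory Num.Theory.
Import numFieldNormedType.Exports.
Local Open Scope classical_set_scope.
Local Open Scope ring_scope.

(* Let phi map the orbit closure of x to the odometer. Take the fiber product
   of pairs (x', y) such that y splits into words a_n, b_n exactly at the places
   prescribed by phi(x'), for every n, and let L* be any minimal subsystem of
   it. L* projects onto the orbit closure of x, which is minimal. If the n-word
   covering position 0 is, for all large n, not among the first six (nor the
   last) of its (n+1)-word, then y is determined by phi(x'). By Borel-Cantelli
   and the summability of 1/k_n this happens almost surely for every invariant
   measure, both on the orbit closure and on L*. Finally L* is odometer based:
   its words are its aligned blocks of length k_0 ... k_(n-1), which are uniquely
   readable because of their second coordinates, and by uniform recurrence all
   of them occur in each other along a sparse sequence of levels n. *)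

Set Implicit Arguments.
Unset Strict Implicit.
Unset Printing Implicit Defensive.

(* MathComp-Analysis has another shift. *)
Local Notation shift := Defs.shift.

(** * Topology of the full shift and minimal subsystems *)

Section Topology.
Variable S : alphabet.
Implicit Types (x y z : fullshift S) (X Y : set (fullshift S)).

Definition agree (N : nat) y z : Prop :=
  forall m : int, (`|m| <= N)%N -> y m = z m.

Lemma agree_sym N y z : agree N y z -> agree N z y.
Proof. by move=> h m mN; rewrite h. Qed.

Lemma agree_trans N x y z : agree N x y -> agree N y z -> agree N x z.
Proof. by move=> h h' m mN; rewrite h// h'. Qed.

Lemma agree_le M N y z : (M <= N)%N -> agree N y z -> agree M y z.
Proof. by move=> MN h m mM; apply: h; apply: leq_trans mM MN. Qed.

Lemma nbhs_agree y N : nbhs y (agree N y).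
Proof.
have coord (m : int) : nbhs y [set z : fullshift S | y m = z m].
  have := @proj_continuous _ (fun=> discrete_topology S) m y.
  by apply; rewrite nbhs_principalE => ? ->.
elim: N => [|N IH].
  by apply: filterS (coord 0) => z h m; rewrite leqn0 absz_eq0 => /eqP ->.
near=> z => m; rewrite leq_eqVlt => /orP[/eqP mN|]; last first.
  rewrite ltnS; move: m; near: z; exact: IH.
have [->|->] : m = N.+1%:Z \/ m = - N.+1%:Z by lia.
- by near: z; exact: coord.
- by near: z; exact: coord.
Unshelve. all: by end_near. Qed.

(** The sets [agree N y] generate a filter that converges to [y] in each coordinate, hence in the
    product topology. From here on topology is handled through agreement on finite intervals. *)
Lemma nbhs_agreeP y (U : set (fullshift S)) :
  nbhs y U <-> exists N, agree N y `<=` U.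
Proof.
split=> [yU|[N NU]]; last by apply: filterS NU _; exact: nbhs_agree.
pose F : set_system (fullshift S) := [set V | exists N, agree N y `<=` V].
have FF : Filter F.
  split; first by exists 0%N.
    move=> P Q [M MP] [N NQ]; exists (maxn M N) => z yz.
    by split; [apply: MP|apply: NQ]; apply: agree_le yz; rewrite ?leq_maxl ?leq_maxr.
  by move=> P Q PQ [N NP]; exists N; apply: subset_trans PQ.
suff : F --> y by apply.
apply/cvg_sup => m; apply/cvg_image.
  by rewrite eqEsubset; split=> // s _; exists (fun=> s).
move=> V; rewrite nbhs_principalE => yV.
exists [set z : fullshift S | V (z m)]; last first.
  rewrite eqEsubset; split => [? [z Vz <-//]|v Vv].
  by exists (fun=> v).
exists `|m|%N => z yz; rewrite /= -yz//; exact: yV.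
Qed.

Lemma closure_agreeP X y :
  closure X y <-> forall N, exists2 z, X z & agree N y z.
Proof.
split=> [Xy N|h B /nbhs_agreeP[N NB]]; last first.
  by have [z Xz yz] := h N; exists z; split=> //; exact: NB.
by have [z [Xz yz]] := Xy _ (nbhs_agree y N); exists z.
Qed.

Lemma closed_agreeP X :
  closed X <-> forall y, (forall N, exists2 z, X z & agree N y z) -> X y.
Proof.
split=> [cX y /closure_agreeP /cX//|h y /closure_agreeP]; exact: h.
Qed.

Lemma fullshift_compact : compact [set: fullshift S].
Proof.
have fin (m : int) : compact [set: discrete_topology S].
  by apply: finite_compact; exact: (@finite_finset S setT).
have := tychonoff fin.
by congr compact; rewrite eqEsubset.
Qed.

(** By compactness finite intersections suffice, and in a chain such an intersection contains one of
    its members. *)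
Lemma closed_chain_nonempty (C : set (set (fullshift S))) :
  (forall X, C X -> closed X /\ X !=set0) -> total_on C subset ->
  \bigcap_(X in C) X !=set0.
Proof.
move=> CX Ctot; have := fullshift_compact; rewrite compact_In0.
apply; first by exists id => [X /CX[]//|X _]; rewrite setTI.
(* The alternative [setT] serves the empty intersection. *)
move=> D DC; have [Y CY YD] : exists2 Y, (C Y \/ Y = setT) &
    Y `<=` \bigcap_(X in [set` D]) X.
  rewrite bigcap_fset /=.
  elim: (finmap.enum_fset D) (DC : forall i, i \in finmap.enum_fset D -> i \in C)
    => {D DC} [|X s IH] sC; first by exists setT; [right|rewrite big_nil].
  have [i|Y CY Ys] := IH; first by move=> ii; apply: sC; rewrite inE ii orbT.
  have /set_mem CX0 : X \in C by apply: sC; rewrite inE eqxx.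
  rewrite big_cons; case: CY => [CY|YT].
    have [XY|YX] := Ctot _ _ CX0 CY.
      by exists X; [left|move=> z Xz; split=> //; apply: Ys; exact: XY].
    by exists Y; [left|move=> z Yz; split; [exact: YX|exact: Ys]].
  by exists X; [left|move=> z Xz; split=> //; apply: Ys; rewrite YT].
suff [z Yz] : Y !=set0 by exists z; exact: YD.
by case: CY => [/CX[]//|->]; exists point.
Qed.

Lemma closed_nested_nonempty (F : nat -> set (fullshift S)) :
  (forall n, closed (F n)) -> (forall n, F n !=set0) ->
  (forall n, F n.+1 `<=` F n) -> exists z, forall n, F n z.
Proof.
move=> Fcl F0 FS.
have Fmon m n : (m <= n)%N -> F n `<=` F m.
  move=> /subnK <-; elim: (n - m)%N => [//|d IH].
  by rewrite addSn; apply: subset_trans IH.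
have [|A B [m _ <-] [n _ <-]|z zF] := @closed_chain_nonempty (range F).
- by move=> X [n _ <-].
- by case/orP: (leq_total m n) => /Fmon; [right|left].
- by exists z => n; apply: zF; exists n.
Qed.

Lemma translate0 y : translate 0 y = y.
Proof. by apply: funext => m; rewrite /translate addr0. Qed.

Lemma translateD m n y : translate m (translate n y) = translate (m + n) y.
Proof. by apply: funext => i; rewrite /translate -addrA. Qed.

Lemma shift_invariantP X : shift_invariant X <->
  forall n y, X y -> X (translate n y).
Proof.
split=> [iX n y Xy|h]; last first.
  rewrite /shift_invariant eqEsubset; split=> y; last exact: h.
  by move=> /= /(h (-1)); rewrite /shift translateD addNr translate0.
have iXP z : X (shift z) <-> X z.
  by split=> [Xz|Xz]; [rewrite -iX|move: Xz; rewrite -{1}iX].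
case: (intP n) => [|{}n|{}n]; first by rewrite translate0.
  elim: n => [|n IH]; first exact: (iXP y).2.
  have := (iXP _).2 IH.
  by rewrite /shift translateD -PoszD add1n.
elim: n => [|n IH]; apply: (iXP _).1; rewrite /shift translateD.
  by rewrite subrr translate0.
by have -> : 1 - n.+2%:Z = - n.+1%:Z by lia.
Qed.

Lemma agree_translate N (n : int) y z :
  agree (N + `|n|) y z -> agree N (translate n y) (translate n z).
Proof. by move=> yz m mN; apply: yz; lia. Qed.

Lemma orbit_closureP x y : orbit_closure x y <->
  forall N, exists n : int, agree N y (translate n x).
Proof.
rewrite /orbit_closure; split=> [/closure_agreeP h N|h].
  by have [_ [n _ <-] ?] := h N; exists n.
by apply/closure_agreeP => N; have [n ?] := h N; exists (translate n x).
Qed.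

Lemma orbit_closure_symbolic x : symbolic_shift (orbit_closure x).
Proof.
split; first exact: closed_closure.
apply/shift_invariantP => n y /orbit_closureP h; apply/orbit_closureP => N.
have [m ym] := h (N + `|n|)%N; exists (n + m); rewrite -translateD.
exact: agree_translate.
Qed.

Lemma orbit_closure_self x : orbit_closure x x.
Proof. by apply/orbit_closureP => N; exists 0; rewrite translate0. Qed.

Lemma orbit_closure_sub X x : symbolic_shift X -> X x -> orbit_closure x `<=` X.
Proof.
move=> [/closed_agreeP cX /shift_invariantP iX] Xx y /orbit_closureP h.
apply: cX => N; have [n yn] := h N; exists (translate n x) => //; exact: iX.
Qed.

Lemma symbolic_shift_bigcap (C : set (set (fullshift S))) :
  C `<=` @symbolic_shift S -> symbolic_shift (\bigcap_(X in C) X).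
Proof.
move=> CX; split; first by apply: closed_bigI => X /CX[].
apply/shift_invariantP => n y Cy X XC.
by have [_ /shift_invariantP] := CX _ XC; apply; exact: Cy.
Qed.

(** Zorn's lemma for the nonempty subshifts of [X] under reverse inclusion; a chain is bounded by
    its intersection, which is nonempty by compactness. *)
Lemma exists_minimal_shift X : symbolic_shift X -> X !=set0 ->
  exists2 Y, Y `<=` X & minimal_shift Y.
Proof.
move=> sX X0; pose P Y := [/\ symbolic_shift Y, Y !=set0 & Y `<=` X].
pose T := {Y | P Y}.
pose rel (Y Z : T) := `[< sval Z `<=` sval Y >].
have [|||A Atot|Y Ymax] := @Zorn T rel.
- by move=> Y; apply/asboolP.
- by move=> Y Z W /asboolP YZ /asboolP ZW; apply/asboolP; apply: subset_trans YZ.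
- move=> [Y PY] [Z PZ] /asboolP /= YZ /asboolP /= ZY.
  have {YZ ZY} YZ : Y = Z by exact/seteqP.
  by rewrite YZ in PY *; congr exist; exact: Prop_irrelevance.
- have [A0|/set0P[Y0 AY0]] := eqVneq A set0.
    have PX : P X by split.
    by exists (exist P X PX) => s; rewrite A0.
  pose C := sval @` A.
  have CC : C `<=` P.
    by move=> Y [Z _ <-]; exact: (svalP Z).
  suff PC : P (\bigcap_(Y in C) Y).
    exists (exist P _ PC) => s As; apply/asboolP => y /=; apply.
    by exists s.
  split.
  + by apply: symbolic_shift_bigcap => Y /CC[].
  + apply: closed_chain_nonempty => [Y /CC[[]]//|_ _ [Y AY <-] [Z AZ <-]].
    by have [/asboolP|/asboolP] := Atot _ _ AY AZ; [right|left].
  + by move=> y Cy; have [_ _] := svalP Y0; apply; apply: Cy; exists Y0.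
- have [sY Y0 YX] := svalP Y; exists (sval Y) => //; split=> // Z sZ Z0 ZY.
  have PZ : P Z by split=> //; apply: subset_trans YX.
  by have <- := Ymax (exist P Z PZ) (asboolT ZY).
Qed.

Lemma minimal_orbit_closure X : symbolic_shift X -> X !=set0 ->
  (forall y, X y -> X `<=` orbit_closure y) -> minimal_shift X.
Proof.
move=> sX X0 Xorb; split=> // Y sY [y Yy] YX; apply/seteqP; split=> //.
by apply: subset_trans (orbit_closure_sub sY Yy); apply: Xorb; exact: YX.
Qed.

End Topology.

(** * Windows, Toeplitz sequences and the words a_n, b_n *)

Section Windows.
Variable S : alphabet.
Implicit Types (x y z : fullshift S) (X Y : set (fullshift S)).

Lemma size_window y i l : size (window y i l) = l.
Proof. exact: size_mkseq. Qed.

Lemma eq_window y z i i' l :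
  (forall j, (j < l)%N -> y (i + j%:Z) = z (i' + j%:Z)) <->
  window y i l = window z i' l.
Proof.
split=> [h|h j jl]; first by apply/eq_in_map => j; rewrite mem_iota => /h.
by have := congr1 (nth point ^~ j) h; rewrite /= !nth_mkseq.
Qed.

Lemma window_cat y i l1 l2 :
  window y i (l1 + l2) = window y i l1 ++ window y (i + l1%:Z) l2.
Proof.
rewrite /window /mkseq iotaD map_cat add0n; congr (_ ++ _).
rewrite -[X in iota X]addn0 iotaDl -map_comp; apply: eq_map => j /=.
by rewrite PoszD addrA.
Qed.

Lemma window_translate n y i l : window (translate n y) i l = window y (i + n) l.
Proof. by apply/eq_window => j _; rewrite /translate addrAC. Qed.

Lemma window_infix y i l d l' : (d + l' <= l)%N ->
  infix (window y (i + d%:Z) l') (window y i l).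
Proof.
move=> h; have -> : l = (d + l' + (l - (d + l')))%N by lia.
by rewrite !window_cat -catA; apply/infixP; exists (window y i d);
  exists (window y (i + (d + l')%:Z) (l - (d + l'))).
Qed.

Lemma infix_window s y i l : infix s (window y i l) ->
  exists2 d, (d + size s <= l)%N & s = window y (i + d%:Z) (size s).
Proof.
move=> /infixP[s1 [s2 e]]; exists (size s1).
  by have := congr1 size e; rewrite size_window !size_cat; lia.
have := congr1 size e; rewrite size_window !size_cat => l_eq.
move: e; rewrite l_eq 2!window_cat => /eqP.
rewrite eqseq_cat ?size_window// => /andP[_].
by rewrite eqseq_cat ?size_window// => /andP[/eqP].
Qed.

Lemma agree_window N y (n : int) z :
  window y (- N%:Z) N.*2.+1 = window z (n - N%:Z) N.*2.+1 <->
  agree N y (translate n z).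
Proof.
split=> [/eq_window h m mN|h].
  have := h `|(m + N%:Z)%R|%N; rewrite /translate.
  have -> : - N%:Z + `|(m + N%:Z)%R|%N%:Z = m by lia.
  have -> : n - N%:Z + `|(m + N%:Z)%R|%N%:Z = m + n by lia.
  by apply; lia.
apply/eq_window => j jN; rewrite h; last by lia.
by rewrite /translate; congr (z _); lia.
Qed.

(** Makes a finite word a window of a bi-infinite sequence, so that the lemmas on windows apply to
    words as well. *)
Lemma window_surj (s : seq S) : exists y : fullshift S, window y 0 (size s) = s.
Proof.
exists (fun m : int => nth point s `|m|%N).
apply: (@eq_from_nth _ point) => [|j]; rewrite size_window// => jl.
by rewrite nth_mkseq// add0r.
Qed.

Lemma window_flatten y i l (ws : seq (seq S)) :
  (forall w, w \in ws -> size w = l) ->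
  (window y i (size ws * l) = flatten ws <->
   forall j, (j < size ws)%N ->
     window y (i + (j * l)%:Z) l = nth [::] ws j).
Proof.
elim: ws i => [|w ws IH] i wl; first by split.
have wl' w' : w' \in ws -> size w' = l by move=> h; apply: wl; rewrite inE h orbT.
rewrite /= mulSn window_cat; split.
  move/eqP; rewrite eqseq_cat ?size_window ?wl ?mem_head//.
  move=> /andP[/eqP wE /eqP/IH-/(_ wl') h] [|j] jl /=.
    by rewrite mul0n addr0.
  by rewrite -h// mulSn PoszD addrA.
move=> h; congr (_ ++ _); first by have := h 0%N isT; rewrite mul0n addr0.
apply/IH => // j jl; have := h j.+1 jl.
by rewrite mulSn PoszD addrA.
Qed.

Lemma limit_symbolic (W : nat -> set (seq S)) : symbolic_shift (Defs.limit W).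
Proof.
split.
  apply/closed_agreeP => y h i l.
  have [z Wz yz] := h (`|i| + l)%N.
  suff -> : window y i l = window z i l by exact: Wz.
  by apply/eq_window => j jl; apply: yz; lia.
by apply/shift_invariantP => n y Wy i l; rewrite window_translate; exact: Wy.
Qed.

(** The product of the periods of the positions in a window is a common period of all of them. *)
Lemma toeplitz_window_period x : toeplitz x -> forall i l,
  exists2 q : nat, (0 < q)%N & forall j : int,
    window x (i + j * q%:Z) l = window x i l.
Proof.
move=> xT i; elim=> [|l [q q0 qP]]; first by exists 1%N.
have [p p0 pP] := xT (i + l%:Z).
exists (p * q)%N => [|j]; first by rewrite muln_gt0 p0.
rewrite -(addn1 l) !window_cat; congr (_ ++ _).
  by rewrite PoszM mulrA qP.
rewrite /window /mkseq /= !addr0 [RHS](_ : _ = [:: x (i + l%:Z)])//.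
congr [:: _]; rewrite (pP (j * q%:Z)); congr (x _); lia.
Qed.

(** The central windows of [x] recur with bounded gaps, so every [y] in the orbit closure shows them
    too, and [x] lies in the orbit closure of [y]. *)
Lemma toeplitz_orbit_closure_minimal x :
  toeplitz x -> minimal_shift (orbit_closure x).
Proof.
move=> xT; apply: minimal_orbit_closure.
- exact: orbit_closure_symbolic.
- by exists x; exact: orbit_closure_self.
move=> y Xy; apply: orbit_closure_sub; first exact: orbit_closure_symbolic.
apply/orbit_closureP => N.
have [q q0 qP] := toeplitz_window_period xT (- N%:Z) N.*2.+1.
(* The extra radius [q] leaves room for an occurrence that is up to [q] away from the origin. *)
move/orbit_closureP : Xy => /(_ (N + q)%N) [n yn].
have q0' : q%:Z != 0 by lia.
(* x shows its central window at every multiple of q; pick the multiple a*q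
   with n <= a*q < n + q *)
pose a := (n %/ q%:Z)%Z + 1.
have aE : 0 <= a * q%:Z - n <= q%:Z.
  have := divz_eq n q%:Z; have := modz_ge0 n q0'.
  have := ltz_mod n q0'; rewrite /a mulrDl mul1r; lia.
exists (a * q%:Z - n); apply/agree_window.
rewrite -(qP a); apply/eq_window => j jN; rewrite yn; last by lia.
by rewrite /translate; congr (x _); lia.
Qed.

End Windows.

(** * Lengths, block structure and unique readability of the words a_n, b_n *)

Lemma flatten_map_infix (T U : eqType) (f : T -> seq U) s t :
  infix s t -> infix (flatten (map f s)) (flatten (map f t)).
Proof.
by move=> /infixP[t1 [t2 ->]]; rewrite !map_cat !flatten_cat; apply/infixP;
  exists (flatten (map f t1)), (flatten (map f t2)).
Qed.

(** K_n, which is the length of the n-words and the order of the n-th finite quotient of the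
    odometer. *)
Definition Kperiod (k : nat -> nat) (n : nat) : nat := (\prod_(i < n) k i)%N.

Section Kwords.
Variable k : nat -> nat.
Hypothesis k_ge : forall n, (12 <= k n)%N.

Local Notation K := (Kperiod k).

Lemma Kperiod0 : K 0 = 1%N. Proof. by rewrite /Kperiod big_ord0. Qed.

Lemma KperiodS n : K n.+1 = (K n * k n)%N.
Proof. by rewrite /Kperiod big_ord_recr. Qed.

Lemma Kperiod_gt n : (n < K n)%N.
Proof.
elim: n => [|n IH]; first by rewrite Kperiod0.
by rewrite KperiodS; have := k_ge n; nia.
Qed.

Lemma Kperiod_dvd m n : (m <= n)%N -> (K m %| K n)%N.
Proof.
move=> /subnK <-; elim: (n - m)%N => [//|d IH].
by rewrite addSn KperiodS dvdn_mulr.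
Qed.

Lemma Kperiod_gt0 n : (0 < K n)%N. Proof. by have := Kperiod_gt n; lia. Qed.

Lemma Kperiod_le m n : (m <= n)%N -> (K m <= K n)%N.
Proof. by move=> /Kperiod_dvd; apply: dvdn_leq; exact: Kperiod_gt0. Qed.

(** The letters of [Kpattern], freed from the length of the pattern. From position 6 on they do not
    depend on [c], which is what makes generic fibers singletons. *)
Definition Kletter (c : bool) (i : nat) : bool :=
  if (i < 3)%N then c else if (i < 6)%N then ~~ c else odd i.

Lemma nth_Kpattern l c i : (i < l)%N -> nth false (Kpattern l c) i = Kletter c i.
Proof. by move=> il; rewrite nth_mkseq. Qed.

Lemma size_Kword n c : size (Kword k n c) = K n.
Proof.
elim: n c => [|n IH] c; first by rewrite Kperiod0.
rewrite /= size_flatten /shape -map_comp KperiodS.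
rewrite (eq_map (g := fun=> K n)) => [|d /=]; last exact: IH.
rewrite -[in RHS](size_mkseq (fun i : nat => Kletter c i) (k n)) -/(Kpattern _ _).
by elim: (Kpattern _ _) => [|d s IHs]; rewrite /= ?muln0// mulnS IHs.
Qed.

(** Each pattern begins with its own letter; hence the two n-words are distinct. *)
Lemma head_Kword n c : nth false (Kword k n c) 0 = c.
Proof.
elim: n c => [//|n IH] c /=; have := k_ge n; rewrite /Kpattern.
case: (k n) => [//|l] _ /=; rewrite nth_cat size_Kword Kperiod_gt0; exact: IH.
Qed.

Lemma Kword_inj n : injective (Kword k n).
Proof. by move=> c d e; rewrite -(head_Kword n c) e head_Kword. Qed.

Lemma Kword_split n c (y : fullshift bool) i :
  window y i (K n.+1) = Kword k n.+1 c <->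
  forall j, (j < k n)%N -> window y (i + (j * K n)%:Z) (K n) = Kword k n (Kletter c j).
Proof.
have szP : size [seq Kword k n d | d <- Kpattern (k n) c] = k n.
  by rewrite size_map size_mkseq.
have := @window_flatten _ y i (K n) [seq Kword k n d | d <- Kpattern (k n) c].
rewrite szP mulnC -KperiodS => -[|h1 h2].
  by move=> _ /mapP[d _ ->]; rewrite size_Kword.
have nthP j : (j < k n)%N ->
    nth [::] [seq Kword k n d | d <- Kpattern (k n) c] j = Kword k n (Kletter c j).
  by move=> jk; rewrite (nth_map false) ?size_mkseq// nth_Kpattern.
split=> [/h1 h j jk|h]; first by rewrite h// nthP.
by apply: h2 => j jk; rewrite h// nthP.
Qed.

Lemma Kword_blocks m n c (y : fullshift bool) i : (m <= n)%N ->
  window y i (K n) = Kword k n c -> forall j, (j * K m < K n)%N ->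
  exists c', window y (i + (j * K m)%:Z) (K m) = Kword k m c'.
Proof.
elim: n c i => [|n IH] c i.
  rewrite leqn0 => /eqP -> h j; rewrite Kperiod0 muln1 ltnS leqn0 => /eqP ->.
  by exists c; rewrite -Kperiod0 addr0.
rewrite leq_eqVlt => /orP[/eqP-> h j|].
  rewrite -{2}(mul1n (K n.+1)) ltn_pmul2r ?Kperiod_gt0// ltnS leqn0 => /eqP ->.
  by exists c; rewrite mul0n addr0.
rewrite ltnS => mn /Kword_split h j jK.
have Kn0 := Kperiod_gt0 n; have Km0 := Kperiod_gt0 m.
(* An n-word consists of [e] words of level [m], so block [j] is block [j %% e] of the n-word with
   number [j %/ e]. *)
have /dvdnP[e eE] := Kperiod_dvd mn.
have e0 : (0 < e)%N by move: Kn0; rewrite eE muln_gt0 => /andP[].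
have /h hq : (j %/ e < k n)%N.
  by rewrite ltn_divLR//; move: jK; rewrite KperiodS eE mulnAC ltn_pmul2r// mulnC.
have [|c' h'] := IH _ _ mn hq (j %% e)%N.
  by rewrite eE ltn_pmul2r// ltn_mod.
exists c'; rewrite -h'; congr (window y _ _).
by rewrite -addrA -PoszD eE mulnA -mulnDl -divn_eq.
Qed.

(* A window shifted by q would have to read c c c followed by three times the
   other letter, which happens at the start of a pattern only. *)
Lemma Kletter_aligned c1 c2 c3 l q : (12 <= l)%N -> (q < l)%N ->
  (forall t, (t < l)%N ->
     (if (q + t < l)%N then Kletter c1 (q + t) else Kletter c2 (q + t - l))
     = Kletter c3 t) -> q = 0%N.
Proof.
move=> l12 ql h; apply/eqP; rewrite -leqn0 leqNgt; apply/negP => q0.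
(* For an offset below 6 the first six letters stay inside the first pattern, as q + 5 < 12, and
   finitely many cases remain. *)
have [q6|q6] := ltnP q 6.
  have {}h t : (t < 6)%N -> Kletter c1 (q + t) = Kletter c3 t.
    by move=> t6; rewrite -h; [rewrite ifT//; lia|lia].
  move: (h 0%N isT) (h 1%N isT) (h 2%N isT) (h 3%N isT) (h 4%N isT) (h 5%N isT).
  by move: q q6 q0 {ql h} => [|[|[|[|[|[|q]]]]]]//= _ _; case: c1; case: c3.
(* Here the first two letters are read in the alternating tail and differ, although both should be
   [c3]. *)
have [q1|q1] := ltnP q.+1 l.
  have e0 : odd q = c3.
    rewrite -[RHS](h 0%N); last by lia.
    by rewrite addn0 ql /Kletter !ifF //; lia.
  have : ~~ odd q = c3.
    rewrite -[RHS](h 1%N); last by lia.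
    by rewrite addn1 q1 /Kletter !ifF //; lia.
  by rewrite e0; case: (c3).
(* At the last offset, the letters 1 and 3 of the window are the letters 0 and 2 of the second
   pattern. These are equal, but the letters 1 and 3 of a pattern are not. *)
have qE : l = q.+1 by lia.
have e1 : c2 = c3.
  rewrite -[RHS](h 1%N); last by lia.
  by rewrite ifF; [rewrite /Kletter ifT//; lia|lia].
have : c2 = ~~ c3.
  rewrite -[RHS](h 3%N); last by lia.
  by rewrite ifF; [rewrite /Kletter ifT//; lia|lia].
by rewrite e1; case: (c3).
Qed.

(** This is the core of unique readability. Write d = q K_n + r for (n+1)-words. The first n-word of
    the third word lies in two successive n-words at offset r, so r = 0 by induction; then its
    pattern is read at offset q, and [Kletter_aligned] gives q = 0. *)
Lemma Kword_aligned n (y : fullshift bool) i c1 c2 c3 d : (d < K n)%N ->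
  window y i (K n) = Kword k n c1 ->
  window y (i + (K n)%:Z) (K n) = Kword k n c2 ->
  window y (i + d%:Z) (K n) = Kword k n c3 -> d = 0%N.
Proof.
elim: n i c1 c2 c3 d => [|n IH] i c1 c2 c3 d; first by rewrite Kperiod0; case: d.
have Kn0 := Kperiod_gt0 n; have kn := k_ge n.
move=> dK /Kword_split h1 /Kword_split h2 /Kword_split h3.
pose e j := if (j < k n)%N then Kletter c1 j else Kletter c2 (j - k n).
have h j : (j < k n + k n)%N ->
    window y (i + (j * K n)%:Z) (K n) = Kword k n (e j).
  move=> j2; rewrite /e; case: (ltnP j (k n)) => jk; first exact: h1.
  rewrite -h2; last by lia.
  by congr (window y _ _); rewrite -addrA -PoszD KperiodS; congr (_ + _%:Z); nia.
have dE := divn_eq d (K n); set q := (d %/ K n)%N in dE.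
set r := (d %% K n)%N in dE.
have rK : (r < K n)%N by rewrite ltn_mod.
have qk : (q < k n)%N by rewrite ltn_divLR// mulnC -KperiodS.
have r0 : r = 0%N.
  apply: (IH (i + (q * K n)%:Z) (e q) (e q.+1) (Kletter c3 0)) => //.
  - by apply: h; lia.
  - by rewrite -addrA -PoszD addnC -mulSn; apply: h; lia.
  - by rewrite -addrA -PoszD -dE -h3 ?mul0n ?addr0//; lia.
suff q0 : q = 0%N by rewrite dE r0 q0.
apply: (Kletter_aligned (c1 := c1) (c2 := c2) (c3 := c3) kn qk) => t tk.
apply: (@Kword_inj n); rewrite -h3// -[LHS]h; last by lia.
by rewrite dE r0 addn0 mulnDl PoszD addrA.
Qed.

(** These eight letters already contain all four two-letter words, whichever letter [c] is. *)
Lemma Kpattern_prefix n c : exists s,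
  Kpattern (k n) c = [:: c; c; c; ~~ c; ~~ c; ~~ c; false; true] ++ s.
Proof.
have -> : k n = (8 + (k n - 8))%N by have := k_ge n; lia.
by rewrite /Kpattern /mkseq iotaD map_cat; eexists; congr (_ ++ _).
Qed.

Lemma Kword_infix n c c' : infix (Kword k n c) (Kword k n.+1 c').
Proof.
have [s sE] := Kpattern_prefix n c'.
rewrite -[X in infix X _]cats0.
apply: (@flatten_map_infix _ _ (Kword k n) [:: c]); rewrite sE.
by case: c; case: c' {sE}; rewrite /= ?prefix0s.
Qed.

(** Needed for windows that cross the border between two n-words. *)
Lemma Kword_infix2 n c c' :
  infix (Kword k n c ++ Kword k n c') (Kword k n.+1 false).
Proof.
have [s sE] := Kpattern_prefix n false.
rewrite -[X in infix (_ ++ X) _]cats0.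
apply: (@flatten_map_infix _ _ (Kword k n) [:: c; c']); rewrite sE.
by case: c; case: c'; rewrite /= ?prefix0s.
Qed.

(** A window of length 2 K_n lies in an m-word with m at least n; this m-word splits into n-words,
    one of which is contained in the window. *)
Lemma Kshift_has_word y n : Kshift k y ->
  exists i c, window y i (K n) = Kword k n c.
Proof.
move=> /(_ 0 (K n + K n)%N)[m [_ [d _ <-]]].
have [z zE] := window_surj (Kword k m d); rewrite size_Kword in zE.
rewrite -zE => /infix_window[t]; rewrite size_window => tK yz.
have Kn0 := Kperiod_gt0 n.
have mn : (n <= m)%N.
  by rewrite leqNgt; apply/negP => /ltnW /Kperiod_le; lia.
(* The first n-word that starts after position [t]. *)
pose j := (t %/ K n).+1.
have tE := divn_eq t (K n); have tr := ltn_pmod t Kn0.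
have [|c jc] := Kword_blocks mn zE (j := j).
  by rewrite /j mulSn; lia.
exists (j * K n - t)%N%:Z, c; rewrite -jc; apply/eq_window => l lK.
move/eq_window : yz => /(_ (j * K n - t + l)%N).
rewrite !add0r PoszD => ->; last by rewrite /j mulSn; lia.
by congr (z _); rewrite /j mulSn; lia.
Qed.

(** Every point contains an (n+1)-word, hence both n-words and all words inside them. A point of
    [Kshift k] will come from the fiber product. *)
Lemma Kshift_minimal : Kshift k !=set0 -> minimal_shift (Kshift k).
Proof.
move=> K0; apply: minimal_orbit_closure => //; first exact: limit_symbolic.
move=> y Ky z Kz; apply/orbit_closureP => N.
have [n [_ [c _ <-] zc]] := Kz (- N%:Z) N.*2.+1.
have [i [d yd]] := Kshift_has_word n.+1 Ky.
have := infix_trans zc (Kword_infix n c d); rewrite -yd.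
move=> /infix_window[t _]; rewrite size_window => zy.
by exists (i + t%:Z + N%:Z); apply/agree_window; rewrite addrK.
Qed.

End Kwords.

(** * Positions in the odometer *)

Section OdometerPosition.
Variable k : nat -> nat.
Hypothesis k_ge : forall n, (12 <= k n)%N.
Local Notation K := (Kperiod k).

Definition odometer_digit (n : nat) (o : odometer k) : nat :=
  let c : 'Z_(k n) := o n in c.

(** The image of [o] in Z/K_n, with the coordinates as mixed radix digits. It will be the position
    of the origin in its n-word. *)
Definition odometer_pos (n : nat) (o : odometer k) : nat :=
  (\sum_(i < n) odometer_digit i o * K i)%N.

Lemma odometer_digit_lt n o : (odometer_digit n o < k n)%N.
Proof.
rewrite /odometer_digit; have := ltn_ord (o n : 'Z_(k n)).
by rewrite [X in (_ < X)%N -> _]Zp_cast//; have := k_ge n; lia.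
Qed.

Lemma odometer_posS n o :
  odometer_pos n.+1 o = (odometer_pos n o + odometer_digit n o * K n)%N.
Proof. by rewrite /odometer_pos big_ord_recr. Qed.

Lemma odometer_pos_lt n o : (odometer_pos n o < K n)%N.
Proof.
elim: n => [|n IH]; first by rewrite /odometer_pos big_ord0 Kperiod0.
by rewrite odometer_posS KperiodS; have := odometer_digit_lt n o; nia.
Qed.

Lemma odometer_posS_mod n o : (odometer_pos n.+1 o %% K n)%N = odometer_pos n o.
Proof. by rewrite odometer_posS addnC modnMDl modn_small// odometer_pos_lt. Qed.

Lemma odometer_posS_div n o :
  (odometer_pos n.+1 o %/ K n)%N = odometer_digit n o.
Proof.
rewrite odometer_posS addnC divnMDl ?(Kperiod_gt0 k_ge)//.
by rewrite divn_small ?addn0// odometer_pos_lt.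
Qed.

Lemma Zp_add1 m (c : 'Z_m) : (1 < m)%N -> ((c + 1)%R : nat) = (c.+1 %% m)%N.
Proof.
by move=> m1; rewrite /= modnDmr addn1 [X in (_ %% X)%N]Zp_cast.
Qed.

Lemma Zp_eqN1 m (c : 'Z_m) : (1 < m)%N -> (c == -1) = (c.+1 == m :> nat).
Proof.
move=> m1; rewrite -addr_eq0 -[LHS]/(nat_of_ord (c + 1) == 0%N) Zp_add1//.
have cm : (c < m)%N by have := ltn_ord c; rewrite [X in (_ < X)%N -> _]Zp_cast.
have [->|cm'] := eqVneq c.+1 m; first by rewrite modnn.
by rewrite modn_small//; lia.
Qed.

(** All digits are maximal exactly when the mixed radix number is K_n - 1. This turns the carry rule
    of [odometer_map] into addition of 1 modulo K_n. *)
Lemma odometer_carry n (o : odometer k) :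
  [forall j : 'I_n, ((o j : 'Z_(k j)) == -1)] = ((odometer_pos n o).+1 == K n).
Proof.
elim: n => [|n IH].
  by rewrite /odometer_pos big_ord0 Kperiod0 eqxx; apply/forallP => -[].
have k1 : (1 < k n)%N by have := k_ge n; lia.
have -> : [forall j : 'I_n.+1, ((o j : 'Z_(k j)) == -1)] =
    [forall j : 'I_n, ((o j : 'Z_(k j)) == -1)] && ((o n : 'Z_(k n)) == -1).
  apply/forallP/andP => [h|[/forallP h hn] j].
    by split; [apply/forallP => j; exact: (h (widen_ord (leqnSn n) j))|
               exact: (h ord_max)].
  case: (unliftP ord_max j) => [i ->|->//].
  by have := h i; rewrite /= /bump leqNgt ltn_ord.
rewrite IH Zp_eqN1// odometer_posS -/(odometer_digit n o) KperiodS.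
have := odometer_digit_lt n o; have := odometer_pos_lt n o.
move: (odometer_pos n o) (odometer_digit n o) (K n) (k n) => a d K' k' aK dk.
apply/andP/eqP => [[/eqP <- /eqP <-]|e]; first by lia.
have dk' : d.+1 = k' by nia.
by split; apply/eqP; [nia|].
Qed.

Lemma odometer_pos_map n o :
  odometer_pos n (odometer_map o) = ((odometer_pos n o).+1 %% K n)%N.
Proof.
elim: n => [|n IH]; first by rewrite /odometer_pos !big_ord0 Kperiod0.
rewrite !odometer_posS IH.
have -> : odometer_digit n (odometer_map o) =
   if (odometer_pos n o).+1 == K n then ((odometer_digit n o).+1 %% k n)%N
   else odometer_digit n o.
  rewrite -odometer_carry /odometer_digit /odometer_map.
  by case: ifP => // _; rewrite Zp_add1//; have := k_ge n; lia.
have dk := odometer_digit_lt n o; have pK := odometer_pos_lt n o.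
case: eqP => [pE|pE].
  rewrite pE modnn add0n KperiodS -addSn pE -mulSn.
  by rewrite (mulnC (K n)) muln_modl.
have {}pE : ((odometer_pos n o).+1 < K n)%N by lia.
by rewrite !modn_small// KperiodS; nia.
Qed.

End OdometerPosition.

(** A coordinate of [phi] is continuous into a discrete space, hence locally constant on [X]. *)
Lemma factor_odometer_pos (S : alphabet) (X : set (fullshift S)) k
    (phi : fullshift S -> odometer k) n y :
  odometer_factor X phi -> X y ->
  exists N, forall z, X z -> agree N y z ->
    odometer_digit n (phi z) = odometer_digit n (phi y).
Proof.
move=> [phic _ _] Xy.
have := (subspace_continuousP X phi).1 phic y Xy.
move=> /(_ [set o | odometer_digit n o = odometer_digit n (phi y)]).
have H : nbhs (phi y)
    [set o : odometer k | odometer_digit n o = odometer_digit n (phi y)].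
  have := @proj_continuous _ (fun n => discrete_topology 'Z_(k n)) n (phi y).
  move=> /(_ [set c | c = (phi y) n]); rewrite nbhs_principalE.
  move=> /(_ (fun c (h : c = (phi y) n) => h)).
  move=> V; apply: (@filterS _ (nbhs (phi y)) _ _ _ _ V) => c cE.
  by rewrite /= /odometer_digit (_ : c n = phi y n).
move=> /(_ H); rewrite /fmap /within /= => /nbhs_agreeP[N NP].
by exists N => z Xz yz; apply: NP.
Qed.

(** * Minimal shifts with a block structure are odometer based *)

Section MinimalShifts.
Variables (S : alphabet) (X : set (fullshift S)).
Hypothesis Xmin : minimal_shift X.

Lemma minimal_translate n y : X y -> X (translate n y).
Proof. by case: Xmin => -[_ /shift_invariantP iX] _ _; exact: iX. Qed.

(** Otherwise points avoiding the word on ever longer central intervals would, by compactness, yield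
    a point that avoids it everywhere, and the orbit closure of that point could not be [X]. *)
Lemma minimal_recurrent z i l : X z -> exists N, forall z', X z' ->
  exists2 t, (t < N)%N & window z' t%:Z l = window z i l.
Proof.
move=> Xz; apply: contrapT => /forallNP noN.
pose F N := [set z' | X z' /\
  forall t : int, (`|t| <= N)%N -> window z' t l <> window z i l].
have [cX X0 Xleast] := Xmin.
have [||N z' [Xz' h]|z0 z0F] := @closed_nested_nonempty _ F.
- move=> N; apply/closed_agreeP => y h; split.
    by apply: ((closed_agreeP _).1 cX.1 y) => M; have [z' [Xz' _] ?] := h M; exists z'.
  move=> t tN; have [z' [_ /(_ t tN) z't] yz'] := h (N + l)%N.
  suff -> : window y t l = window z' t l by [].
  by apply/eq_window => j jl; apply: yz'; lia.
(* A stretch of 2N + 1 positions without the word is moved so that it is centred at the origin. *)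
- move=> N; have /existsNP[z' /not_implyP[Xz' h]] := noN N.*2.+1.
  exists (translate N%:Z z'); split; first exact: minimal_translate.
  move=> t tN; rewrite window_translate => e; apply: h.
  by exists `|(t + N%:Z)%R|%N; [lia|rewrite -e; congr (window _ _ _); lia].
- by split=> // t tN; apply: h; lia.
have z0X : X z0 by have [] := z0F 0%N.
have XE := Xleast _ (@orbit_closure_symbolic _ z0)
  (ex_intro _ z0 (@orbit_closure_self _ z0)) (orbit_closure_sub cX z0X).
move: Xz; rewrite -{1}XE => /orbit_closureP /(_ (`|i| + l)%N)[n zn].
have [_ /(_ (i + n) (leqnn _))] := z0F `|(i + n)%R|%N; apply.
by rewrite -window_translate; apply/eq_window => j jl; rewrite zn//; lia.
Qed.

(** There are finitely many words of length [l], so their recurrence bounds have a maximum. *)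
Lemma minimal_uniformly_recurrent l : exists N, forall z z', X z -> X z' ->
  exists2 t, (t < N)%N & window z' t%:Z l = window z 0 l.
Proof.
have /choice[f fP] : forall w : l.-tuple S, exists N, forall z z', X z -> X z' ->
    window z 0 l = w -> exists2 t, (t < N)%N & window z' t%:Z l = w.
  move=> w; have [[z [Xz zw]]|h] := pselect (exists z, X z /\ window z 0 l = w).
    have [N NP] := minimal_recurrent 0 l Xz.
    by exists N => _ z' _ Xz' _; have [t tN e] := NP _ Xz'; exists t; rewrite // e.
  by exists 0%N => z z' Xz _ zw; case: h; exists z.
exists (\max_w f w)%N => z z' Xz Xz'.
have wP : size (window z 0 l) == l by rewrite size_window.
have [t tN e] := fP (Tuple wP) z z' Xz Xz' erefl.
by exists t => //; apply: leq_trans tN _; exact: leq_bigmax.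
Qed.

End MinimalShifts.

Lemma multiple_lt_eq0 (a K : nat) (e : int) :
  (a < K)%N -> a%:Z = e * K%:Z -> a = 0%N.
Proof.
move=> aK aE; have : (a%:Z %% K%:Z)%Z = 0 by rewrite aE modzMl.
by rewrite modz_nat modn_small// => -[].
Qed.

Section BlockStructure.
Variables (T : alphabet) (X : set (fullshift T)) (K : nat -> nat).
(** [q n z] stands for the position of the origin in the block of level [n] that covers it, and
    [K n] for the length of such blocks. *)
Variable q : nat -> fullshift T -> nat.
Hypothesis Xmin : minimal_shift X.
Hypothesis K0 : K 0%N = 1%N.
Hypothesis K_dvd : forall m n, (m <= n)%N -> (K m %| K n)%N.
Hypothesis K_lt : forall m n, (m < n)%N -> (K m < K n)%N.
Hypothesis K_gt : forall n, (n < K n)%N.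
Hypothesis q_lt : forall n z, (q n z < K n)%N.
Hypothesis q_mod : forall m n z, (m <= n)%N -> (q n z %% K m)%N = q m z.
Hypothesis q_translate : forall n (m : int) z, X z ->
  exists e : int, (q n (translate m z))%:Z = (q n z)%:Z + m + e * (K n)%:Z.

Definition aligned_words (n : nat) : set (seq T) :=
  [set w | exists z, [/\ X z, q n z = 0%N & w = window z 0 (K n)]].

Hypothesis aligned_words_ur : forall n, uniquely_readable (aligned_words n).

Lemma aligned_point n : exists2 z, X z & q n z = 0%N.
Proof.
have [_ [z Xz] _] := Xmin.
exists (translate (- (q n z)%:Z) z); first exact: minimal_translate.
have [e qe] := q_translate n (- (q n z)%:Z) Xz.
by apply: (multiple_lt_eq0 (e := e) (q_lt n _)); rewrite qe subrr add0r.
Qed.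

Lemma aligned_words_sub m n z j : X z -> q n z = 0%N -> (m <= n)%N ->
  aligned_words m (window z (j * K m)%:Z (K m)).
Proof.
move=> Xz q0 mn; exists (translate (j * K m)%:Z z); split.
- exact: minimal_translate.
- have [e] := q_translate m (j * K m)%:Z Xz.
  rewrite -(q_mod z mn) q0 mod0n => qe.
  apply: (multiple_lt_eq0 (e := j%:Z + e) (q_lt m _)).
  by rewrite qe add0r PoszM mulrDl.
- by rewrite window_translate add0r.
Qed.

Lemma aligned_words_occur m : exists2 n, (m < n)%N &
  forall w w', aligned_words m w -> aligned_words n w' -> infix w w'.
Proof.
have [N NP] := minimal_uniformly_recurrent Xmin (K m).
(* Since [K n] exceeds [n], a block of level [n] has room for an occurrence of length [K m] that
   starts before [N]. *)
pose n := (m + N + K m)%N.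
exists n => [|_ _ [z [Xz _ ->]] [z' [Xz' _ ->]]].
  by rewrite /n; have := K_gt m; lia.
have [t tN <-] := NP _ _ Xz Xz'.
rewrite -[t%:Z]add0r; apply: window_infix.
by have := K_gt n; rewrite {1}/n; lia.
Qed.

(** Along a sparse sequence [s] of levels, every aligned word occurs in all those of the next level.
    The limit is [X]: aligned words are words of [X], and each word of [X] recurs in every long
    aligned word. *)
Lemma minimal_odometer_based : odometer_based X.
Proof.
have /choice[f fP] : forall m, exists n, (m < n)%N /\
    forall w w', aligned_words m w -> aligned_words n w' -> infix w w'.
  by move=> m; have [n ? ?] := aligned_words_occur m; exists n.
(* Starting at level 0, where blocks have length 1, makes the first collection consist of
   letters. *)
pose s j := iter j f 0%N.
have sS j : (s j < s j.+1)%N by rewrite /s /=; have [] := fP (iter j f 0%N).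
have s_ge j : (j <= s j)%N by elim: j => [//|j IH]; have := sS j; lia.
have [cX X0 Xleast] := Xmin.
exists (finset.finset (fun c => `[< exists2 z, X z & z 0 = c >])).
exists (fun j => aligned_words (s j)).
  exists (fun j => K (s j.+1) %/ K (s j))%N; split.
  - move=> j; have /dvdnP[e eE] := K_dvd (ltnW (sS j)).
    have := K_lt (sS j); rewrite eE mulnK; last by have := K_gt (s j); lia.
    by case: e {eE} => [|[|]]//; rewrite ?mul0n ?mul1n ?ltnn.
  - rewrite /s /= eqEsubset; split=> w.
      move=> [z [Xz _ ->]]; exists (z 0); last by rewrite K0.
      by rewrite /= inE; apply/asboolP; exists z.
    move=> [c /=]; rewrite inE => /asboolP[z Xz <-] <-; exists z; split=> //.
      by have := q_lt 0 z; rewrite K0; lia.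
    by rewrite K0.
  - by move=> j u v [? [_ _ ->]] [? [_ _ ->]]; rewrite !size_window.
  - by move=> j; exact: aligned_words_ur.
  - move=> j; split=> [|_ [z [Xz qz ->]]]; first by have [] := fP (s j).
    have /dvdnP[e eE] := K_dvd (ltnW (sS j)).
    have Ks : (0 < K (s j))%N by have := K_gt (s j); lia.
    rewrite eE mulnK//.
    exists (mkseq (fun i => window z (i * K (s j))%:Z (K (s j))) e).
      split=> [|_ /mapP[i _ ->]]; first exact: size_mkseq.
      exact: aligned_words_sub qz (ltnW (sS j)).
    rewrite -[X in window _ _ (X * _)](size_mkseq
      (fun i => window z (i * K (s j))%:Z (K (s j))) e).
    apply/window_flatten => [_ /mapP[i _ ->]|i]; first by rewrite size_window.
    by rewrite size_mkseq => ie; rewrite nth_mkseq// add0r.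
rewrite eqEsubset; split=> [z Xz i l|y yW].
  have [N NP] := minimal_recurrent Xmin i l Xz.
  have [z' Xz' qz'] := aligned_point (s (N + l)%N).
  exists (N + l)%N, (window z' 0 (K (s (N + l)%N))); first by exists z'.
  have [t tN <-] := NP _ Xz'.
  rewrite -[t%:Z]add0r; apply: window_infix.
  by have := K_gt (s (N + l)%N); have := s_ge (N + l)%N; lia.
apply: ((closed_agreeP _).1 cX.1 y) => N.
have [n [_ [z [Xz _ ->]] /infix_window[d _]]] := yW (- N%:Z) N.*2.+1.
rewrite size_window add0r => yz; exists (translate (d%:Z + N%:Z) z).
  exact: minimal_translate.
by apply/agree_window; rewrite addrK.
Qed.

End BlockStructure.

(** * The fiber product over the odometer *)

Section FiberProduct.
Variables (S : alphabet) (X : set (fullshift S)) (k : nat -> nat).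
Variable phi : fullshift S -> odometer k.
Hypothesis k_ge : forall n, (12 <= k n)%N.
Hypothesis Xmin : minimal_shift X.
Hypothesis phiF : odometer_factor X phi.
Local Notation K := (Kperiod k).
Local Notation digit n y := (odometer_digit n (phi y)).
Local Notation pos n y := (odometer_pos n (phi y)).

Lemma pos_local n y : X y ->
  exists N, forall z, X z -> agree N y z -> pos n z = pos n y.
Proof.
move=> Xy; elim: n => [|n [N NP]].
  by exists 0%N => z _ _; rewrite /odometer_pos !big_ord0.
have [M MP] := factor_odometer_pos n phiF Xy.
exists (maxn M N) => z Xz yz; rewrite !odometer_posS NP//; last first.
  exact: agree_le (leq_maxr _ _) yz.
by rewrite MP//; exact: agree_le (leq_maxl _ _) yz.
Qed.

Lemma pos_mod m n y : (m <= n)%N -> (pos n y %% K m)%N = pos m y.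
Proof.
move=> /subnK <-; elim: (n - m)%N => [|d IH].
  by rewrite modn_small// odometer_pos_lt.
rewrite -IH -(odometer_posS_mod k_ge (d + m)) addSn.
by rewrite modn_dvdm//; apply: Kperiod_dvd; rewrite leq_addl.
Qed.

Lemma pos_translate_nat n (m : nat) y : X y ->
  pos n (translate m%:Z y) = ((pos n y + m) %% K n)%N.
Proof.
move=> Xy; have [_ _ phiS] := phiF.
elim: m => [|m IH].
  by rewrite translate0 addn0 modn_small// odometer_pos_lt.
rewrite -addn1 PoszD addrC -translateD -/(shift _) phiS; last first.
  exact: minimal_translate.
by rewrite odometer_pos_map// IH -addn1 modnDml addnA.
Qed.

(** The congruence modulo K_n carries an explicit multiple [e] so that linear arithmetic can use it.
    Negative [m] is reduced to translating back. *)
Lemma pos_translate n (m : int) y : X y ->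
  exists e : int, (pos n (translate m y))%:Z = (pos n y)%:Z + m + e * (K n)%:Z.
Proof.
have nat_case (l : nat) z : X z -> exists e : int,
    (pos n (translate l%:Z z))%:Z = (pos n z)%:Z + l%:Z + e * (K n)%:Z.
  move=> Xz; rewrite pos_translate_nat//.
  exists (- ((pos n z + l) %/ K n)%N%:Z).
  by have := divn_eq (pos n z + l) (K n); lia.
case: (intP m) => [|l|l] Xy; [exact: (nat_case 0%N)|exact: nat_case|].
have Xy' := minimal_translate Xmin (- l.+1%:Z) Xy.
have [e] := nat_case l.+1 _ Xy'.
rewrite translateD subrr translate0 => ->; exists (- e); lia.
Qed.

(** The odometer point of the first coordinate prescribes where the n-words of the second one start;
    no factor map on [Kshift k] has to be named. *)
Definition fiber_product : set (fullshift (S * bool)%type) :=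
  [set z | X (fstshift z) /\ forall n (j : int), exists c,
     window (sndshift z) (j * (K n)%:Z - (pos n (fstshift z))%:Z) (K n)
     = Kword k n c].

Lemma agree_fst N (y z : fullshift (S * bool)%type) :
  agree N y z -> agree N (fstshift y) (fstshift z).
Proof. by move=> yz m mN; rewrite /fstshift yz. Qed.

Lemma agree_snd N (y z : fullshift (S * bool)%type) :
  agree N y z -> agree N (sndshift y) (sndshift z).
Proof. by move=> yz m mN; rewrite /sndshift yz. Qed.

Lemma fiber_product_symbolic : symbolic_shift fiber_product.
Proof.
split.
  apply/closed_agreeP => z h.
  have Xz : X (fstshift z).
    have [[cX _] _ _] := Xmin.
    apply: ((closed_agreeP _).1 cX) => N.
    by have [y [Xy _] zy] := h N; exists (fstshift y) => //; exact: agree_fst.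
  split=> // n j; have [N NP] := pos_local n Xz.
  set i := j * _ - _; have [y [Xy yP] zy] := h (N + `|i| + K n)%N.
  have [c cP] := yP n j; exists c; rewrite -cP NP//; last first.
    by apply: agree_le (agree_fst zy); lia.
  by apply/eq_window => l lK; apply: (agree_snd zy); lia.
apply/shift_invariantP => m z [Xz zP].
have Xz' := minimal_translate Xmin m Xz.
split=> // n j; have [e eP] := pos_translate n m Xz.
(* Translation renumbers the n-words by the multiple [e] of K_n by which the position wraps
   around. *)
have [c cP] := zP n (j - e); exists c.
rewrite -cP [LHS](window_translate m (sndshift z)).
congr (window _ _ _); rewrite [fstshift _](_ : _ = translate m (fstshift z))//.
rewrite eP; lia.
Qed.

(** As K_l > l, a window of length [l] fits into two successive l-words, and these occur side by
    side in a_(l+1). *)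
Lemma Kshift_of_blocks (y : fullshift bool) (p : nat -> nat) :
  (forall n (j : int), exists c,
     window y (j * (K n)%:Z - (p n)%:Z) (K n) = Kword k n c) -> Kshift k y.
Proof.
move=> yP i l; exists l.+1, (Kword k l.+1 false); first by exists false.
have Kl := Kperiod_gt k_ge l; have K0 : (K l)%:Z != 0 by lia.
pose j := ((i + (p l)%:Z) %/ (K l)%:Z)%Z.
have [c cP] := yP l j; have [c' c'P] := yP l (j + 1).
apply: infix_trans (Kword_infix2 k_ge l c c').
have iE := divz_eq (i + (p l)%:Z) (K l)%:Z.
have r0 := modz_ge0 (i + (p l)%:Z) K0.
have rK : ((i + (p l)%:Z) %% (K l)%:Z)%Z < (K l)%:Z by apply: ltz_pmod; lia.
rewrite -/j in iE; set r := (_ %% _)%Z in iE r0 rK.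
have -> : Kword k l c ++ Kword k l c' =
    window y (j * (K l)%:Z - (p l)%:Z) (K l + K l).
  rewrite window_cat cP; congr (_ ++ _); rewrite -c'P.
  by congr (window _ _ _); lia.
have -> : i = j * (K l)%:Z - (p l)%:Z + `|r|%N%:Z by lia.
by apply: window_infix; lia.
Qed.

Lemma fiber_product_sub : fiber_product `<=` prodshift X (Kshift k).
Proof. by move=> z [Xz zP]; split=> //; exact: Kshift_of_blocks zP. Qed.

(** The n-word at the origin has a whole n-word on either side within its (n+1)-word, and K_n > n.
    So this (n+1)-word covers the interval from -n to n. *)
Lemma generic_exhaust n y : (6 <= digit n y)%N -> ((digit n y).+1 < k n)%N ->
  (n < pos n.+1 y)%N /\ (n + pos n.+1 y < K n.+1)%N.
Proof.
rewrite odometer_posS KperiodS.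
have := odometer_pos_lt k_ge n (phi y); have := Kperiod_gt k_ge n.
move: (odometer_digit _ _) (odometer_pos _ _) (K n) (k n); nia.
Qed.

(* Over a point all of whose digits are 7 the words b_n are nested, since 7 is
   odd and at least 6, and they exhaust the integers. *)
Lemma fiber_product_nonempty : fiber_product !=set0.
Proof.
have [_ phiT _] := phiF.
have [x0 Xx0 phix0] : (phi @` X) (fun n => inZp 7) by rewrite phiT.
have dig n : digit n x0 = 7%N.
  rewrite /odometer_digit phix0 /= [X in (_ %% X)%N]Zp_cast.
    by rewrite modn_small//; have := k_ge n; lia.
  by have := k_ge n; lia.
pose F n := [set y : fullshift bool |
  window y (- (pos n x0)%:Z) (K n) = Kword k n true].
have FP n y : F n.+1 y -> F n y.
  move=> /Kword_split /(_ 7%N) yn; rewrite /F /= -[RHS]yn; last first.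
    by have := k_ge n; lia.
  by congr (window _ _ _); rewrite odometer_posS dig; lia.
have [||n|y yF] := @closed_nested_nonempty _ F.
- move=> n; apply/closed_agreeP => y h.
  have [z zE yz] := h (pos n x0 + K n)%N; rewrite /F /= -zE.
  by apply/eq_window => j jK; apply: yz; lia.
- move=> n; have [y yP] := window_surj (Kword k n true).
  exists (translate (pos n x0)%:Z y).
  by rewrite /F /= window_translate addNr -[RHS]yP size_Kword.
- exact: FP.
exists (pairshift x0 y); split=> // n j.
rewrite [fstshift _](_ : _ = x0)// [sndshift _](_ : _ = y)//.
(* Large enough for the (m+1)-word at the origin to cover the n-word with number [j], which is
   number [j + e] from its start. *)
pose m := (n + (`|j| + 2) * K n)%N.
have [||m1 m2] := @generic_exhaust m x0.
- by rewrite dig.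
- by rewrite dig; have := k_ge m; lia.
have mE := divn_eq (pos m.+1 x0) (K n).
rewrite (pos_mod x0 (_ : n <= m.+1)%N) in mE; last by rewrite /m; lia.
set e := (_ %/ _)%N in mE; have pK := odometer_pos_lt k_ge n (phi x0).
have je : 0 <= j + e%:Z by move: m1; rewrite mE /m; nia.
have [||c cP] := Kword_blocks k_ge (_ : n <= m.+1)%N (yF m.+1) (j := `|(j + e%:Z)%R|%N).
- by rewrite /m; lia.
- by move: m2; rewrite mE /m; nia.
by exists c; rewrite -cP; congr (window _ _ _); rewrite mE; nia.
Qed.

Definition generic_digits (o : odometer k) : Prop :=
  exists N, forall n, (N <= n)%N ->
    (6 <= odometer_digit n o)%N /\ ((odometer_digit n o).+1 < k n)%N.

(** A digit that is at least 6 determines the n-word at the origin by its parity, whatever the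
    (n+1)-word is, and these words exhaust the integers. *)
Lemma fiber_product_unique z z' : fiber_product z -> fiber_product z' ->
  fstshift z = fstshift z' -> generic_digits (phi (fstshift z)) ->
  sndshift z = sndshift z'.
Proof.
move=> [Xz zP] [_ z'P] zz'; rewrite -zz' in z'P; set y := fstshift z in Xz zP z'P *.
move=> [N NP].
have blk w n : (6 <= digit n y)%N ->
    (forall n (j : int), exists c,
     window w (j * (K n)%:Z - (pos n y)%:Z) (K n) = Kword k n c) ->
    window w (- (pos n y)%:Z) (K n) = Kword k n (odd (digit n y)).
  move=> d6 wP; have [c] := wP n.+1 0; rewrite mul0r add0r.
  move=> /Kword_split /(_ _ (odometer_digit_lt k_ge n (phi y))).
  rewrite /Kletter !ifF; [|lia|lia] => <-.
  by congr (window _ _ _); rewrite odometer_posS; lia.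
(* Digit [n] makes the (n+1)-word at the origin cover [m]; digit n + 1 determines that word. *)
apply: funext => m; pose n := (N + `|m|)%N.
have [d6 dk] := NP n (leq_addr _ _).
have [d6' _] := NP n.+1 (leq_trans (leq_addr _ _) (leqnSn _)).
have [m1 m2] := generic_exhaust d6 dk.
have := blk _ _ d6' zP; rewrite -(blk _ _ d6' z'P) => /eq_window.
move=> /(_ `|(m + (pos n.+1 y)%:Z)%R|%N).
have -> : - (pos n.+1 y)%:Z + `|(m + (pos n.+1 y)%:Z)%R|%N%:Z = m.
  by move: m1; rewrite /n; lia.
by apply; move: m2; rewrite /n; lia.
Qed.

(** * Minimal subsystems of the fiber product *)

Section MinimalSubsystem.
Variable Z : set (fullshift (S * bool)%type).
Hypothesis Zmin : minimal_shift Z.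
Hypothesis ZM : Z `<=` fiber_product.

(** By compactness the projection of [Z] is closed, hence a nonempty subshift of the minimal [X]. *)
Lemma subsystem_onto : [set fstshift z | z in Z] = X.
Proof.
have [[cZ iZ] [z0 Zz0] _] := Zmin; have [sX _ Xleast] := Xmin.
apply: Xleast; last 1 first.
- by move=> _ [z /ZM[? _] <-].
- split.
    apply/closed_agreeP => y h.
    have [||N z [Zz yz]|z zP] := @closed_nested_nonempty _
        (fun N => [set z | Z z /\ agree N y (fstshift z)]).
    + move=> N; apply/closed_agreeP => z zh; split.
        by apply: ((closed_agreeP _).1 cZ) => M; have [z' []] := zh M; exists z'.
      have [z' [_ yz'] zz'] := zh N.
      exact: agree_trans yz' (agree_sym (agree_fst zz')).
    + by move=> N; have [_ [z Zz <-] yz] := h N; exists z.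
    + by split=> //; exact: agree_le yz.
    exists z; first by have [] := zP 0%N.
    by apply: funext => m; have [_ ->] := zP `|m|%N.
  apply/shift_invariantP => n _ [z Zz <-]; exists (translate n z) => //.
  exact: minimal_translate.
- by exists (fstshift z0), z0.
Qed.

Lemma subsystem_odometer_based : odometer_based Z.
Proof.
apply: (@minimal_odometer_based _ _ K (fun n z => pos n (fstshift z)) Zmin).
- exact: Kperiod0.
- exact: Kperiod_dvd.
- move=> m n mn; apply: leq_trans (Kperiod_le k_ge mn).
  rewrite KperiodS; have := k_ge m; have := Kperiod_gt0 k_ge m; nia.
- exact: Kperiod_gt.
- by move=> n z; exact: odometer_pos_lt.
- by move=> m n z; exact: pos_mod.
- by move=> n m z /ZM[Xz _]; exact: pos_translate.
move=> n u v w p s.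
have wordP t : aligned_words Z K (fun n z => pos n (fstshift z)) n t ->
    exists c, map snd t = Kword k n c.
  move=> [z [/ZM[_ /(_ n 0)[c cP]] z0 ->]]; exists c; rewrite -cP z0 mul0r subr0.
  by rewrite /window /mkseq -map_comp.
move=> /wordP[c1 uc] /wordP[c2 vc] /wordP[c3 wc] uv.
have szP (t : seq (S * bool)%type) c : map snd t = Kword k n c -> size t = K n.
  by move=> e; rewrite -(size_Kword k n c) -e size_map.
have := congr1 size uv; rewrite !size_cat (szP _ _ uc) (szP _ _ vc) (szP _ _ wc).
(* If [p] has at least K_n letters, lengths force [s] to be empty; otherwise the second coordinates
   are aligned, so [p] is empty. *)
move=> sz; have [pK|Kp] := ltnP (size p) (K n); last first.
  by right; apply: size0nil; lia.
left; apply: size0nil; have [y yP] := window_surj (map snd (u ++ v)).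
rewrite size_map size_cat (szP _ _ uc) (szP _ _ vc) in yP.
move: (yP); rewrite map_cat uc vc window_cat => /eqP.
rewrite eqseq_cat ?size_window ?size_Kword// => /andP[/eqP y1 /eqP y2].
apply: (Kword_aligned k_ge pK y1 y2 (c3 := c3)).
move: yP; rewrite sz uv !map_cat wc !window_cat => /eqP.
rewrite eqseq_cat ?size_window ?size_map// => /andP[_].
by rewrite eqseq_cat ?size_window ?size_Kword// => /andP[/eqP].
Qed.

End MinimalSubsystem.

End FiberProduct.

(** * Generic points have full measure *)

Lemma closed_borel (T : ptopologicalType) (B : set T) :
  closed B -> measurable (B : set (borel T)).
Proof.
move=> cB; rewrite -(setCK B); apply: measurableC.
by apply: sub_sigma_algebra; exact: closed_openC.
Qed.

Lemma open_shift (S : alphabet) (V : set (fullshift S)) :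
  open V -> open (@shift S @^-1` V).
Proof.
move=> oV; rewrite openE => y /= Vy.
have /nbhs_agreeP[N NV] : nbhs (shift y) V by exact: open_nbhs_nbhs.
apply/nbhs_agreeP; exists (N + 1)%N => z yz.
by apply: NV; exact: (@agree_translate _ N 1).
Qed.

Section GenericMeasure.
Variables (R : realType) (T : alphabet) (Y : set (fullshift T)).
Variable mu : probability (borel (fullshift T)) R.
Hypothesis Ysym : symbolic_shift Y.
Hypothesis muY : invariant_on Y mu.

Lemma invariant_translate (n : nat) (B : set (borel (fullshift T))) :
  measurable B ->
  measurable (@translate T n%:Z @^-1` B : set (borel (fullshift T))) /\
  mu (@translate T n%:Z @^-1` B) = mu B.
Proof.
move=> mB; elim: n => [|n [mBn muBn]].
  by rewrite (_ : translate _ @^-1` B = B)//; apply: funext => y;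
    rewrite /preimage /= translate0.
have -> : @translate T n.+1%:Z @^-1` B = @shift T @^-1` (@translate T n%:Z @^-1` B).
  by apply: funext => y; rewrite /preimage /= /shift translateD -PoszD addn1.
split; last by rewrite muY.1.
have : @measurable_fun _ _ (borel (fullshift T)) (borel (fullshift T))
    setT (@shift T).
  apply: (@measurability _ _ (borel (fullshift T)) (borel (fullshift T))
    setT (@shift T) (@open (fullshift T))) => //.
  move=> _ [V oV <-]; rewrite setTI; apply: sub_sigma_algebra.
  exact: open_shift.
by move=> /(_ measurableT _ mBn); rewrite setTI.
Qed.

(** Translation by [m] permutes the [l] disjoint level sets of [d] cyclically, so they have equal
    measure and total at most 1. *)
Lemma cyclic_fiber_measure (d : fullshift T -> nat) (l m : nat) i :
  (forall j, closed [set y | Y y /\ d y = j]) -> (0 < l)%N ->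
  (forall y, (d y < l)%N) ->
  (forall y, Y y -> d (translate m%:Z y) = ((d y).+1 %% l)%N) ->
  (i < l)%N -> (mu [set y | Y y /\ d y = i] <= (l%:R^-1)%:E)%E.
Proof.
move=> dcl l0 dl dS il; pose E j : set (borel (fullshift T)) := [set y | Y y /\ d y = j].
have mE j : measurable (E j) := closed_borel (dcl j).
have ES j : (j.+1 < l)%N -> mu (E j) = mu (E j.+1).
  move=> jl; have [_ <-] := invariant_translate m (mE j.+1).
  congr (mu _); apply: funext => y; apply/propext.
  have iY := (shift_invariantP Y).1 Ysym.2.
  have Yt : Y (translate m%:Z y) -> Y y.
    by move=> /(iY (- m%:Z)); rewrite translateD addNr translate0.
  split=> [[Yy dy]|[/Yt Yy]].
    by split; [exact: iY|rewrite dS// dy modn_small].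
  rewrite dS// => dy; split=> //.
  have := dl y; rewrite leq_eqVlt => /orP[/eqP dyl|dyl].
    by move: dy; rewrite dyl modnn.
  by move: dy; rewrite modn_small// => -[].
have {}ES j : (j < l)%N -> mu (E j) = mu (E 0%N).
  by elim: j => [//|j IH] jl; rewrite -ES// IH//; lia.
have : (mu (\big[setU/set0]_(j < l) E j) <= 1)%E.
  by apply: probability_le1; apply: bigsetU_measurable.
rewrite measure_bigsetU//; last first.
  by move=> a b _ _ [y [[_ <-] [_ <-]]].
have muE j : mu (E j) = (fine (mu (E j)))%:E by rewrite fineK// fin_num_measure.
rewrite (eq_bigr (fun=> (fine (mu (E i)))%:E)) => [|j _]; last first.
  by rewrite -muE; transitivity (mu (E 0%N)); [exact: ES|apply/esym/ES].
rewrite sumEFin sumr_const card_ord lee_fin => h.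
by rewrite -/(E i) muE lee_fin -[leRHS]div1r ler_pdivlMr ?ltr0n// mulr_natr.
Qed.

Variables (k K : nat -> nat) (d : nat -> fullshift T -> nat).
Hypothesis k_ge : forall n, (12 <= k n)%N.
Hypothesis k_summable : cvgn (series (fun n => (k n)%:R^-1 : R)).
Hypothesis d_closed : forall n j, closed [set y | Y y /\ d n y = j].
Hypothesis d_lt : forall n y, (d n y < k n)%N.
Hypothesis d_translate : forall n y, Y y ->
  d n (translate (K n)%:Z y) = ((d n y).+1 %% k n)%N.

(* The digits 0, ..., 5 are those of the six n-words that depend on the
   (n+1)-word; k_n - 1 is added to make the complement shift invariant. *)
Definition exceptional (n : nat) : set (borel (fullshift T)) :=
  \big[setU/set0]_(i < 7)
    [set y | Y y /\ d n y = if (i < 6)%N then nat_of_ord i else (k n).-1].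

Lemma exceptionalP n y : Y y -> ~ exceptional n y ->
  (6 <= d n y)%N /\ ((d n y).+1 < k n)%N.
Proof.
move=> Yy h; have {}h i : (i < 7)%N ->
    d n y <> if (i < 6)%N then i else (k n).-1.
  move=> i7 di; apply: h; rewrite /exceptional (bigD1 (Ordinal i7))//=.
  by left.
split; first by rewrite leqNgt; apply/negP => d6; apply: (h (d n y)); rewrite ?d6//; lia.
by have := h 6%N isT; have := d_lt n y; have := k_ge n; rewrite /=; lia.
Qed.

Lemma exceptional_inv n y : exceptional n y ->
  Y y /\ ~ ((6 <= d n y)%N /\ ((d n y).+1 < k n)%N).
Proof.
rewrite /exceptional -(bigcup_mkord 7
  (fun i => [set y | Y y /\ d n y = if (i < 6)%N then i else (k n).-1])).
move=> -[i /= i7 [Yy dE]]; split=> //.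
by rewrite dE; case: (ltnP i 6) => i6; have := k_ge n; lia.
Qed.

Lemma measurable_exceptional n : measurable (exceptional n).
Proof. by apply: bigsetU_measurable => i _; exact: closed_borel. Qed.

Lemma measure_exceptional n : (mu (exceptional n) <= (7 * (k n)%:R^-1)%:E)%E.
Proof.
have := @Boole_inequality _ _ _ mu (fun i => [set y | Y y /\
  d n y = if (i < 6)%N then i else (k n).-1] : set (borel (fullshift T))) 7.
move=> /(_ (fun i _ => closed_borel (@d_closed _ _))) /le_trans; apply.
rewrite (_ : 7 * _ = \sum_(i < 7) (k n)%:R^-1); last first.
  by rewrite sumr_const card_ord mulr_natl.
rewrite -sumEFin; apply: lee_sum => i _.
have kn := k_ge n; apply: (@cyclic_fiber_measure _ (k n) (K n)) => //; first by lia.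
- exact: d_translate.
- by case: ifP => _; have := ltn_ord i; lia.
Qed.

(** Borel-Cantelli: the measures are at most 7 / k_n, which is summable. *)
Lemma measure_lim_sup_exceptional : mu (lim_sup_set exceptional) = 0%E.
Proof.
apply: lim_sup_set_cvg0; first exact: measurable_exceptional.
apply: (@le_lt_trans _ _ (\sum_(n <oo) (7 * (k n)%:R^-1)%:E)%E).
  by apply: lee_nneseries => // n _; exact: measure_exceptional.
have c7 : cvgn (series (fun n => 7 * (k n)%:R^-1 : R)) by exact: is_cvg_seriesZ.
have -> : (fun n => \sum_(0 <= i < n) (7 * (k i)%:R^-1)%:E)%E =
    EFin \o series (fun n => 7 * (k n)%:R^-1 : R).
  by apply: funext => n; rewrite /= /series /= sumEFin.
by rewrite EFin_lim// ltry.
Qed.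

Lemma measurable_lim_sup_exceptional : measurable (lim_sup_set exceptional).
Proof.
apply: bigcap_measurable => [|n _]; first by exists 0%N.
by apply: bigcup_measurable => j _; exact: measurable_exceptional.
Qed.

Lemma generic_lim_sup : [set y | Y y /\ exists N, forall n, (N <= n)%N ->
    (6 <= d n y)%N /\ ((d n y).+1 < k n)%N] = Y `\` lim_sup_set exceptional.
Proof.
apply/seteqP; split=> y [Yy].
  move=> [N NP]; split=> // /(_ N I)[n /= Nn /exceptional_inv[_]]; apply.
  exact: NP.
move=> /existsNP[N /not_implyP[_ h]]; split=> //; exists N => n Nn.
by apply: exceptionalP => // yn; apply: h; exists n.
Qed.

End GenericMeasure.

(** * Behaviour of the digits under translation *)

Section GenericPoints.
Variables (S : alphabet) (X : set (fullshift S)) (k : nat -> nat).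
Variable phi : fullshift S -> odometer k.
Hypothesis k_ge : forall n, (12 <= k n)%N.
Hypothesis Xmin : minimal_shift X.
Hypothesis phiF : odometer_factor X phi.
Local Notation K := (Kperiod k).
Local Notation digit n y := (odometer_digit n (phi y)).
Local Notation pos n y := (odometer_pos n (phi y)).

(** Moving by K_n keeps the lower digits and passes to the next n-word. *)
Lemma digit_translate n y : X y ->
  digit n (translate (K n)%:Z y) = ((digit n y).+1 %% k n)%N.
Proof.
move=> Xy; rewrite -(odometer_posS_div k_ge n (phi (translate _ _))).
rewrite (pos_translate_nat k_ge Xmin phiF)// odometer_posS KperiodS.
rewrite -addnA -mulSnr; have K0 := Kperiod_gt0 k_ge n.
have aK := odometer_pos_lt k_ge n (phi y); have dk := odometer_digit_lt k_ge n (phi y).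
have [dE|dk'] := eqVneq (digit n y).+1 (k n).
  rewrite dE modnn mulnC addnC modnDl modn_small ?divn_small//.
  by rewrite (leq_trans aK)// leq_pmulr//; lia.
have {}dk : ((digit n y).+1 < k n)%N by rewrite ltn_neqAle dk' dk.
rewrite [in RHS]modn_small// modn_small; last by nia.
by rewrite addnC divnMDl// divn_small// addn0.
Qed.

(** At high levels the origin and [m] lie in the same word, so positions change by exactly [m] and
    the high digits do not change at all. *)
Lemma generic_translate (m : int) y : X y ->
  generic_digits (phi y) -> generic_digits (phi (translate m y)).
Proof.
move=> Xy [N NP]; exists (N + `|m|)%N.+1 => n Nn.
have posE l : (N + `|m| <= l)%N ->
    (pos l.+1 (translate m y))%:Z = (pos l.+1 y)%:Z + m.
  move=> Nl; have [|d6 dk] := NP l; first by lia.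
  have [m1 m2] := generic_exhaust k_ge d6 dk.
  have [e eP] := pos_translate k_ge Xmin phiF l.+1 m Xy.
  have lt' := odometer_pos_lt k_ge l.+1 (phi (translate m y)).
  have e0 : e = 0.
    move: eP lt' m1 m2; move: (pos _ _) (pos _ _) (K _) => a b c; nia.
  by rewrite eP e0 mul0r addr0.
have -> : digit n (translate m y) = digit n y; last by apply: NP; lia.
case: n Nn => // n Nn; have K0 := Kperiod_gt0 k_ge n.+1.
have e1 := posE n Nn; have := posE n.+1 (ltnW Nn).
rewrite !(odometer_posS n.+1) !PoszD e1 => e2.
by apply/eqP; rewrite -(eqn_pmul2r K0); apply/eqP; lia.
Qed.

Lemma digit_closed n j : closed [set y | X y /\ digit n y = j].
Proof.
have [[cX _] _ _] := Xmin.
apply/closed_agreeP => y h; have Xy : X y.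
  by apply: ((closed_agreeP _).1 cX) => N; have [z []] := h N; exists z.
split=> //; have [N NP] := factor_odometer_pos n phiF Xy.
by have [z [Xz <-] yz] := h N; rewrite (NP z).
Qed.

End GenericPoints.

(** * The system L* and the augmentation *)

Theorem proposition19 (R : realType) (Sigma : alphabet) (x : fullshift Sigma)
    (x_toeplitz : toeplitz x) :
  exists g : seq nat -> nat,
  forall k : nat -> nat,
    (forall n, (1 < k n)%N) ->
    cvgn (series (fun n => (k n)%:R^-1 : R)) ->
    fast_growing g k ->
    maximal_odometer_factor (orbit_closure x) k ->
    exists Lstar A : set (fullshift (Sigma * bool)%type),
      [/\ odometer_based Lstar,
          Lstar `<=` prodshift (orbit_closure x) (Kshift k),
          A `<=` Lstar,
          augmentation R (orbit_closure x) (Kshift k) A &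
          forall mu : probability (borel (fullshift (Sigma * bool)%type)) R,
            invariant_on Lstar mu -> mu A = 1%E].
Proof.
(* Twelve letters per pattern suffice for unique readability. *)
exists (fun=> 12%N) => k _ k_summable k_ge [phi [phiF _]].
set X := orbit_closure x in phiF *.
have Xmin : minimal_shift X := toeplitz_orbit_closure_minimal x_toeplitz.
have Xsym : symbolic_shift X by have [] := Xmin.
have [Z ZM Zmin] := exists_minimal_shift
  (fiber_product_symbolic k_ge Xmin phiF) (fiber_product_nonempty k_ge phiF).
have Zsym : symbolic_shift Z by have [] := Zmin.
have ZX z : Z z -> X (fstshift z) by move=> /ZM[].
have Zonto := subsystem_onto Xmin Zmin ZM.
pose A := [set z | Z z /\ generic_digits (phi (fstshift z))].
pose dX n (y : fullshift Sigma) := odometer_digit n (phi y).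
pose dZ n (z : fullshift (Sigma * bool)%type) := dX n (fstshift z).
have d_lt n o := odometer_digit_lt k_ge n (o : odometer k).
have dZ_closed n j : closed [set z | Z z /\ dZ n z = j].
  apply/closed_agreeP => z h; have Zz : Z z.
    by apply: ((closed_agreeP _).1 Zsym.1) => N; have [w []] := h N; exists w.
  split=> //; have [N NP] := factor_odometer_pos n phiF (ZX _ Zz).
  have [w [Zw <-] zw] := h N.
  by symmetry; apply: NP; [exact: ZX|exact: agree_fst].
have dZ_translate n z : Z z ->
    dZ n (translate (Kperiod k n)%:Z z) = ((dZ n z).+1 %% k n)%N.
  by move=> /ZX Xz; exact: (digit_translate k_ge Xmin phiF n Xz).
(* This shows that [A] is Borel and that only a null set of [Z] is missing from it. *)
have AE : A = Z `\` lim_sup_set (exceptional Z k dZ).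
  by rewrite -(generic_lim_sup Z k_ge (fun n z => d_lt n (phi (fstshift z)))).
have mE : measurable (lim_sup_set (exceptional Z k dZ)).
  exact: measurable_lim_sup_exceptional.
have mA : measurable (A : set (borel (fullshift (Sigma * bool)%type))).
  by rewrite AE; apply: measurableD => //; exact: closed_borel Zsym.1.
exists Z, A; split.
- exact: (subsystem_odometer_based k_ge Xmin phiF Zmin ZM).
- by apply: subset_trans ZM _; exact: fiber_product_sub.
- by move=> z [].
- split.
  + split=> //; apply: Kshift_minimal => //.
    have [z /(fiber_product_sub k_ge)[_ Kz]] := fiber_product_nonempty k_ge phiF.
    by exists (sndshift z).
  + by move=> z [/ZM /(fiber_product_sub k_ge)].
  + apply/shift_invariantP => n z [Zz gz]; split; first exact: minimal_translate.
    exact: (generic_translate k_ge Xmin phiF n (ZX _ Zz) gz).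
  + exact: mA.
  + move=> mu muX.
    (* A null set outside of which fibers are singletons: a point is found since [Z] projects onto
       [X], and it is unique by genericity. *)
    exists (~` X `|` lim_sup_set (exceptional X k dX)).
    have mX : measurable (X : set (borel (fullshift Sigma))).
      exact: closed_borel Xsym.1.
    have mEX : measurable (lim_sup_set (exceptional X k dX)).
      by apply: measurable_lim_sup_exceptional => n j; exact: digit_closed.
    split.
    * by apply: measurableU => //; exact: measurableC.
    * apply/eqP; rewrite eq_le measure_ge0 andbT.
      have -> : (0 = mu (~` X) + mu (lim_sup_set (exceptional X k dX)))%E.
        rewrite probability_setC// muX.2 subee// add0e.
        rewrite (@measure_lim_sup_exceptional _ _ _ _ Xsym muX k (Kperiod k) dX)//.
        - by move=> n j; exact: digit_closed.
        - by move=> n y; exact: d_lt.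
        - by move=> n y; exact: (digit_translate k_ge Xmin phiF).
      by apply: measureU2 => //; exact: measurableC.
    * move=> y /= ynot; apply: contrapT => /not_orP[/contrapT Xy yE].
      apply: ynot.
      have [_ gy] : [set y | X y /\ exists N, forall n, (N <= n)%N ->
          (6 <= dX n y)%N /\ ((dX n y).+1 < k n)%N] y.
        by rewrite (generic_lim_sup X k_ge (fun n z => d_lt n (phi z))).
      split=> //; move: (Xy); rewrite -Zonto => -[z Zz zy].
      have zE : z = pairshift y (sndshift z).
        apply: funext => m.
        by rewrite /pairshift -zy /fstshift /sndshift -surjective_pairing.
      exists (sndshift z); split.
        split; first by have [] := fiber_product_sub k_ge (ZM _ Zz).
        by rewrite -zE; split=> //; rewrite zy.
      move=> w [_ [Zw _]].
      apply: (fiber_product_unique k_ge (ZM _ Zz) (ZM _ Zw)); rewrite zy//.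
- move=> mu muZ.
  have muE : mu (lim_sup_set (exceptional Z k dZ)) = 0%E.
    apply: (@measure_lim_sup_exceptional _ _ _ _ Zsym muZ k (Kperiod k) dZ) => //.
    by move=> n z; exact: d_lt.
  have mZ : measurable (Z : set (borel (fullshift (Sigma * bool)%type))).
    exact: closed_borel Zsym.1.
  (* [Z] has measure one and is covered by [A] and the null set. *)
  apply/eqP; rewrite eq_le probability_le1//= -muZ.2 -[leRHS]adde0 -muE.
  apply: le_trans (measureU2 mu mA mE); apply: le_measure.
  + exact/mem_set.
  + exact/mem_set/measurableU.
  + rewrite AE => z Zz.
    by have [|] := pselect (lim_sup_set (exceptional Z k dZ) z); [right|left].
Qed.
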